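(* Let $\mathcal{M}$ be a smooth connected manifold. Then the space $(\mathrm{Met}(\mathcal{M}), \mathbb{d}^{\mathcal{M}})$ of rough Riemannian metrics on $\mathcal{M}$ is a complete extended length metric space.
   Context: $\mathcal{M}$ carries a smooth differentiable structure and has no boundary. A set $Z\subset\mathcal{M}$ has measure zero if its image in every smooth chart has Lebesgue measure zero; ''almost every'' (a.e.) refers to this notion. A rough Riemannian metric on $\mathcal{M}$ is a measurable symmetric $(2,0)$-tensor field $\mathrm{g}$ (a measurable section of symmetric bilinear forms on $T\mathcal{M}$; fields agreeing a.e. are identified) such that for every $x\in\mathcal{M}$ there is a chart $(U,\psi)$ near $x$ and a constant $C_U\ge 1$ with $C_U^{-1}|u|_{\psi^*\delta(y)}\le |u|_{\mathrm{g}(y)}\le C_U|u|_{\psi^*\delta(y)}$ for almost every $y\in U$ and all $u\in T_yU$. Here $|u|_{\mathrm{g}(y)}=\sqrt{\mathrm{g}(y)[u,u]}$ and $\delta$ is the Euclidean metric. $\mathrm{Met}(\mathcal{M})$ is the set of all rough Riemannian metrics on $\mathcal{M}$. For $C\ge1$, write $\mathrm{g}\sim_C\mathrm{h}$ if $C^{-1}|u|_{\mathrm{h}(x)}\le|u|_{\mathrm{g}(x)}\le C|u|_{\mathrm{h}(x)}$ for almost every $x\in\mathcal{M}$ and all $u\in T_x\mathcal{M}$. Define $\mathbb{d}^{\mathcal{M}}(\mathrm{g},\mathrm{h})=\inf\{\log C: C\ge 1,\ \mathrm{g}\sim_C\mathrm{h}\}$ if some such $C$ exists, and $\mathbb{d}^{\mathcal{M}}(\mathrm{g},\mathrm{h})=+\infty$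 otherwise. An extended metric satisfies the axioms of a metric but may take the value $+\infty$. It is complete if every Cauchy sequence converges. It is a length metric if the distance between any two points equals the infimum of the lengths of continuous curves joining them (the infimum being $+\infty$ if there are none), where the length of a curve is the supremum over partitions of the sums of distances between consecutive partition points. *)

(* Defs.v *)
From HB Require Import structures.
From mathcomp Require Import all_boot all_order all_algebra.
From mathcomp Require Import sesquilinear generic_quotient.
From mathcomp Require Import all_classical all_reals all_analysis.
Import Order.TTheory GRing.Theory Num.Theory.
Import numFieldNormedType.Exports.

Set Implicit Arguments.
Unset Strict Implicit.
Unset Printing Implicit Defensive.

Local Open Scope classical_set_scope.
Local Open Scope ring_scope.

Section lebesgue_rV.
Variables (R : realType) (n : nat).
Local Open Scope ereal_scope.

Definition box (b : 'rV[R]_n * 'rV[R]_n) : set 'rV[R]_n :=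
  [set x | forall i, (b.1 ord0 i <= x ord0 i <= b.2 ord0 i)%R].

Definition box_volume (b : 'rV[R]_n * 'rV[R]_n) : \bar R :=
  (\prod_i Num.max (b.2 ord0 i - b.1 ord0 i) 0)%R%:E.

(** The index set [D] lets a cover be empty or finite: when [n = 0] every box
    is a point of volume 1. *)
Definition box_cover (A : set 'rV[R]_n)
    (c : set nat * (nat -> 'rV[R]_n * 'rV[R]_n)) : Prop :=
  A `<=` \bigcup_(k in c.1) box (c.2 k).

Definition lebesgue_outer (A : set 'rV[R]_n) : \bar R :=
  ereal_inf [set \esum_(k in c.1) box_volume (c.2 k) | c in box_cover A].

Lemma box_volume_ge0 b : 0 <= box_volume b.
Proof. by rewrite lee_fin prodr_ge0// => i _; rewrite le_max lexx orbT. Qed.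

Lemma lebesgue_outer_ge0 A : 0 <= lebesgue_outer A.
Proof.
apply: le_ereal_inf_tmp => _ [c _ <-].
by apply: esum_ge0 => k _; exact: box_volume_ge0.
Qed.

Lemma lebesgue_outer0 : lebesgue_outer set0 = 0.
Proof.
apply/eqP; rewrite eq_le lebesgue_outer_ge0 andbT.
apply: ereal_inf_lbound; exists (set0, fun=> (0%R, 0%R)); first by [].
by rewrite esum_set0.
Qed.

Lemma le_lebesgue_outer : {homo lebesgue_outer : A B / A `<=` B >-> A <= B}.
Proof.
move=> A B AB; apply: ereal_inf_le_tmp => _ [c cB <-]; exists c => //.
exact: subset_trans cB.
Qed.

Lemma lebesgue_outer_sigma_subadditive : sigma_subadditive lebesgue_outer.
Proof.
move=> A; have [[i ioo]|] := pselect (exists i, lebesgue_outer (A i) = +oo).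
  rewrite (eseries_pinfty _ _ ioo) ?leey// => k _.
  by rewrite -ltNye (lt_le_trans _ (lebesgue_outer_ge0 _)).
rewrite -forallNE => Aoo.
apply/lee_addgt0Pr => e e0.
apply: (le_trans _ (epsilon_trick _ _ (ltW e0))); last first.
  by move=> k; exact: lebesgue_outer_ge0.
pose P k c := box_cover (A k) c /\
  \esum_(j in c.1) box_volume (c.2 j) <=
    lebesgue_outer (A k) + (e / (2 ^ k.+1)%:R)%:E.
have /(@choice _ _ P)[c Pc] : forall k, exists c, P k c.
  move=> k.
  have fk : lebesgue_outer (A k) \is a fin_num.
    by rewrite ge0_fin_numE ?lebesgue_outer_ge0// ltey; apply/eqP/Aoo.
  have ek : (0 < e / (2 ^ k.+1)%:R)%R by rewrite divr_gt0// ltr0n expn_gt0.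
  have [_ [d dA <-] /ltW dk] := lb_ereal_inf_adherent ek fk.
  by exists d.
have /card_esym/ppcard_eqP[f] := card_nat2.
pose F (p : nat * nat) := (c p.1).2 p.2.
pose K := [set p : nat * nat | (c p.1).1 p.2].
apply: (@le_trans _ _ (\esum_(p in K) box_volume (F p))).
  apply: ereal_inf_lbound; exists (f @^-1` K, F \o f) => /=.
    move=> x [k _ /(Pc k).1[j cj Fx]].
    by exists (f^-1%FUN (k, j)); rewrite /= invK ?inE.
  rewrite (esum_mkcond K) (esum_mkcond (f @^-1` K)).
  by rewrite (reindex_esum [set: nat] [set: nat * nat] f)//.
rewrite (_ : K = [set: nat] `*`` (fun k => (c k).1)); last first.
  by apply/seteqP; split => [[a b] //|[a b] []].
rewrite -(@esum_esum _ _ _ setT (fun k => (c k).1) (fun k j => box_volume (F (k, j)))); last first.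
  by move=> *; exact: box_volume_ge0.
rewrite nneseries_esumT; last first.
  move=> k; apply: adde_ge0; first exact: lebesgue_outer_ge0.
  by rewrite lee_fin divr_ge0 ?ler0n// ltW.
by apply: le_esum => k _; exact: (Pc k).2.
Qed.

HB.instance Definition _ := isOuterMeasure.Build R _ lebesgue_outer
  lebesgue_outer0 lebesgue_outer_ge0 le_lebesgue_outer
  lebesgue_outer_sigma_subadditive.

End lebesgue_rV.

(** R^n with the sigma-algebra of Lebesgue-measurable sets. *)
Definition lebesgue_rV (R : realType) (n : nat) :=
  caratheodory_type (@lebesgue_outer R n).

Section smooth.
Variables (R : realType) (V W : normedModType R).

(** C^k on [U]; only meant for open [U], so that the derivatives at points of
    [U] do not depend on the values of [f] outside [U]. *)
Fixpoint class_C (k : nat) (U : set V) (f : V -> W) : Prop :=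
  if k is k'.+1 then
    (forall x, U x -> differentiable f x) /\ (forall v, class_C k' U ('D_v f))
  else forall x, U x -> {for x, continuous f}.

Definition smooth_on (U : set V) (f : V -> W) : Prop := forall k, class_C k U f.

End smooth.

(** The values of [cmap] outside [cdom], and of [cinv] outside the image of
    [cdom], are irrelevant. *)
Record chart (R : realType) (n : nat) (M : topologicalType) := Chart {
  cdom : set M;
  cmap : M -> 'rV[R]_n;
  cinv : 'rV[R]_n -> M;
  cdom_open : open cdom;
  crange_open : open (cmap @` cdom);
  cmapK : forall x, cdom x -> cinv (cmap x) = x;
  cmap_continuous : forall x, cdom x -> {for x, continuous cmap};
  cinv_continuous : forall p, (cmap @` cdom) p -> {for p, continuous cinv} }.

Section charts.
Variables (R : realType) (n : nat) (M : topologicalType).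
Implicit Types c : chart R n M.

Definition crange c : set 'rV[R]_n := cmap c @` cdom c.

Definition transition c c' : 'rV[R]_n -> 'rV[R]_n := cmap c' \o cinv c.

Definition overlap c c' : set 'rV[R]_n := cmap c @` (cdom c `&` cdom c').

Definition compatible c c' : Prop :=
  smooth_on (overlap c c') (transition c c') /\
  smooth_on (overlap c' c) (transition c' c).

End charts.

Record smooth_manifold (R : realType) (n : nat) := SmoothManifold {
  manifold_sort :> topologicalType;
  manifold_hausdorff : hausdorff_space manifold_sort;
  manifold_second_countable : @second_countable manifold_sort;
  atlas : set (chart R n manifold_sort);
  atlas_cover : forall x, exists2 c, atlas c & cdom c x;
  atlas_compatible : forall c c', atlas c -> atlas c' -> compatible c c';
  atlas_maximal :
    forall c, (forall c', atlas c' -> compatible c c') -> atlas c }.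

Lemma near_diff_comp (R : realType) (U V W : normedModType R) (f : U -> V)
    (g : V -> W) (h : U -> W) (a w : U) (b : V) :
  f a = b -> differentiable f a -> differentiable g b -> differentiable h a ->
  (\forall p \near a, h p = g (f p)) -> 'd h a w = 'd g b ('d f a w).
Proof.
move=> fa df dg dh hgf; rewrite -fa in dg *.
rewrite -deriveE// (near_eq_derive w hgf).
rewrite deriveE; last exact: (differentiable_comp df dg).
by rewrite (diff_comp df dg).
Qed.

Section tangent.
Variables (R : realType) (n : nat) (M : smooth_manifold R n).
Implicit Types (x : M) (c : chart R n M).

Definition chart_at x : Type := {c : chart R n M | atlas c /\ cdom c x}.

(** A tangent vector at [x] is the family of its components in all the smooth
    charts around [x], related by the differentials of the transition maps. *)
Definition tangent_pred x : {pred chart_at x -> 'rV[R]_n} := fun v =>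
  `[< forall c c' : chart_at x,
        v c' = 'd (transition (sval c) (sval c')) (cmap (sval c) x) (v c) >].

Lemma tangent_submod_closed x : submod_closed (@tangent_pred x).
Proof.
split=> [|a u v /asboolP hu /asboolP hv]; apply/asboolP => c c'.
  by rewrite linear0.
by rewrite linearP /= -hu -hv.
Qed.

HB.instance Definition _ x := GRing.isSubmodClosed.Build R
  (chart_at x -> 'rV[R]_n) (@tangent_pred x) (@tangent_submod_closed x).

Record tangent x := Tangent {
  tangent_val : chart_at x -> 'rV[R]_n;
  tangent_valP : tangent_val \in @tangent_pred x }.

HB.instance Definition _ x := [isSub for @tangent_val x].
HB.instance Definition _ x := [Choice of tangent x by <:].
HB.instance Definition _ x := [SubChoice_isSubLmodule of tangent x by <:].


Lemma overlap_nbhs x (c c' : chart_at x) :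
  \forall p \near cmap (sval c) x, overlap (sval c) (sval c') p.
Proof.
have [[_ cx] [_ c'x]] := (svalP c, svalP c').
have rx : (cmap (sval c) @` cdom (sval c)) (cmap (sval c) x) by exists x.
have := @cinv_continuous _ _ _ (sval c) _ rx.
rewrite /prop_for /continuous_at cmapK// => /(_ (cdom (sval c'))) h.
have {h} : \forall p \near cmap (sval c) x, cdom (sval c') (cinv (sval c) p).
  by apply: h; apply: open_nbhs_nbhs; split => //; exact: cdom_open.
have : \forall p \near cmap (sval c) x, (cmap (sval c) @` cdom (sval c)) p.
  by apply: open_nbhs_nbhs; split => //; exact: crange_open.
apply: filterS2 => p [y cy <-]; rewrite cmapK// => c'y.
by exists y.
Qed.

Lemma transition_differentiable x (c c' : chart_at x) :
  differentiable (transition (sval c) (sval c')) (cmap (sval c) x).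
Proof.
have [[ac cx] [ac' c'x]] := (svalP c, svalP c').
have [/(_ 1%N)[d _] _] := atlas_compatible ac ac'.
by apply: d; exists x.
Qed.

Lemma transition_chain x (c c' c'' : chart_at x) (w : 'rV[R]_n) :
  'd (transition (sval c) (sval c'')) (cmap (sval c) x) w =
  'd (transition (sval c') (sval c'')) (cmap (sval c') x)
     ('d (transition (sval c) (sval c')) (cmap (sval c) x) w).
Proof.
have [_ cx] := svalP c.
apply: (@near_diff_comp R _ _ _ (transition (sval c) (sval c'))
  (transition (sval c') (sval c'')) (transition (sval c) (sval c'')));
  rewrite ?/transition/= ?cmapK//; try exact: transition_differentiable.
apply: filterS (overlap_nbhs c c') => p [y [cy c'y] <-].
by rewrite /transition /= !cmapK.
Qed.

Lemma tangent_vec_subproof x (c : chart_at x) (w : 'rV[R]_n) :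
  (fun c' : chart_at x =>
     'd (transition (sval c) (sval c')) (cmap (sval c) x) w)
    \in @tangent_pred x.
Proof. by apply/asboolP => c' c''; exact: transition_chain. Qed.

(** The tangent vector at [x] whose components in the chart [c] are [w]; it is
    0 (a junk value) when [c] is not a smooth chart around [x]. *)
Definition tangent_vec c x (w : 'rV[R]_n) : tangent x :=
  match pselect (atlas c /\ cdom c x) with
  | left h => Tangent (tangent_vec_subproof (exist _ c h) w)
  | right _ => 0
  end.

(** The components [d c_x (u)] of [u] in the chart [c], with the same
    convention. *)
Definition tangent_coord c x (u : tangent x) : 'rV[R]_n :=
  match pselect (atlas c /\ cdom c x) with
  | left h => tangent_val u (exist _ c h)
  | right _ => 0
  end.

Lemma tangent_vecK c x w :
  atlas c -> cdom c x -> tangent_coord c (tangent_vec c x w) = w.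
Proof.
move=> ac cx; rewrite /tangent_coord /tangent_vec; case: pselect => [h|[]//].
rewrite /= -deriveE; last exact: (transition_differentiable (exist _ c h) (exist _ c h)).
rewrite (@near_eq_derive _ _ _ _ id); first by rewrite derive_id.
apply: filterS (overlap_nbhs (exist _ c h) (exist _ c h)).
by move=> p [y [cy _] <-] /=; rewrite /transition /= cmapK.
Qed.

End tangent.

Section rough_metric.
Variables (R : realType) (n : nat) (M : smooth_manifold R n).

Definition measure_zero (Z : set M) : Prop :=
  forall c : chart R n M, atlas c ->
    lebesgue_outer (cmap c @` (Z `&` cdom c)) = 0%E.

Definition almost_everywhere (U : set M) (P : M -> Prop) : Prop :=
  measure_zero [set x | U x /\ ~ P x].

Definition tensor_field : Type := forall x : M, {symmetric (tangent x)}.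

Definition tensor_coef (g : tensor_field) (c : chart R n M) (i j : 'I_n)
    (p : 'rV[R]_n) : R :=
  g (cinv c p) (tangent_vec c (cinv c p) (delta_mx ord0 i))
               (tangent_vec c (cinv c p) (delta_mx ord0 j)).

Definition measurable_tensor (g : tensor_field) : Prop :=
  forall c : chart R n M, atlas c -> forall i j,
    measurable_fun (crange c : set (lebesgue_rV R n))
      (tensor_coef g c i j : lebesgue_rV R n -> R).

Definition tensor_norm (g : tensor_field) (x : M) (u : tangent x) : R :=
  Num.sqrt (g x u u).

(** Norm for the pullback by [c] of the Euclidean metric. *)
Definition pullback_norm (c : chart R n M) (x : M) (u : tangent x) : R :=
  Num.sqrt (\sum_i (tangent_coord c u ord0 i) ^+ 2).

Definition locally_comparable (g : tensor_field) : Prop :=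
  forall x : M, exists c : chart R n M, [/\ atlas c, cdom c x &
    exists2 C : R, 1 <= C &
      almost_everywhere (cdom c) (fun y => forall u : tangent y,
        C^-1 * pullback_norm c u <= tensor_norm g u <= C * pullback_norm c u)].

Record rough_metric := RoughMetric {
  rough_tensor :> forall x : M, {symmetric (tangent x)};
  rough_measurable : measurable_tensor rough_tensor;
  rough_comparable : locally_comparable rough_tensor }.

HB.instance Definition _ := gen_eqMixin rough_metric.
HB.instance Definition _ := gen_choiceMixin rough_metric.

Definition equivalent_by (C : R) (g h : rough_metric) : Prop :=
  almost_everywhere setT (fun x => forall u : tangent x,
    C^-1 * tensor_norm h u <= tensor_norm g u <= C * tensor_norm h u).

(** The infimum of the empty set is [+oo] in [\bar R]. *)
Definition rough_dist (g h : rough_metric) : \bar R :=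
  ereal_inf [set (ln C)%:E | C in [set C | 1 <= C /\ equivalent_by C g h]].

Lemma sub_measure_zero (Y Z : set M) :
  Y `<=` Z -> measure_zero Z -> measure_zero Y.
Proof.
move=> YZ Z0 c ac; apply/eqP; rewrite eq_le lebesgue_outer_ge0 andbT -(Z0 c ac).
by apply: le_lebesgue_outer; apply: image_subset; exact: setSI.
Qed.

Lemma measure_zero_set0 : measure_zero set0.
Proof. by move=> c _; rewrite set0I image_set0 lebesgue_outer0. Qed.

Lemma measure_zeroU (Y Z : set M) :
  measure_zero Y -> measure_zero Z -> measure_zero (Y `|` Z).
Proof.
move=> Y0 Z0 c ac; apply/eqP; rewrite eq_le lebesgue_outer_ge0 andbT.
rewrite setIUl image_setU (le_trans (outer_measureU2 _ _ _))//=.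
by rewrite Y0// Z0// adde0.
Qed.

Definition ae_eq_metric (g h : rough_metric) : bool :=
  `[< almost_everywhere setT (fun x => forall u v, g x u v = h x u v) >].

Lemma ae_eq_metric_refl : reflexive ae_eq_metric.
Proof.
move=> g; apply/asboolP; apply: sub_measure_zero measure_zero_set0.
by move=> x [_ []].
Qed.

Lemma ae_eq_metric_sym : symmetric ae_eq_metric.
Proof.
suff H g h : ae_eq_metric g h -> ae_eq_metric h g.
  by move=> g h; apply/idP/idP; exact: H.
move=> /asboolP gh; apply/asboolP; apply: sub_measure_zero gh.
by move=> x [_ hg]; split => // gh; apply: hg => u v; rewrite gh.
Qed.

Lemma ae_eq_metric_trans : transitive ae_eq_metric.
Proof.
move=> h g k /asboolP gh /asboolP hk; apply/asboolP.
apply: sub_measure_zero (measure_zeroU gh hk) => x [_ gk].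
have [gh'|] := pselect (forall u v, g x u v = h x u v); last by left.
by right; split => // hk'; apply: gk => u v; rewrite gh' hk'.
Qed.

Canonical ae_eq_metric_equiv :=
  EquivRel ae_eq_metric ae_eq_metric_refl ae_eq_metric_sym ae_eq_metric_trans.

Local Open Scope quotient_scope.

(** Rough metrics up to equality almost everywhere. *)
Definition Met : Type := {eq_quot ae_eq_metric}.
HB.instance Definition _ := Choice.on Met.
HB.instance Definition _ := EqQuotient.on Met.

(** Independent of the representatives, see [Met_distE]. *)
Definition Met_dist (g h : Met) : \bar R := rough_dist (repr g) (repr h).

Lemma le_rough_dist_ae_eq (g g' h h' : rough_metric) :
  ae_eq_metric g g' -> ae_eq_metric h h' ->
  (rough_dist g' h' <= rough_dist g h)%E.
Proof.
move=> /asboolP gg' /asboolP hh'.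
apply: ereal_inf_le_tmp => _ [C [C1 gh] <-]; exists C => //; split => //.
apply: sub_measure_zero (measure_zeroU gh (measure_zeroU gg' hh')).
move=> x [_ ngh].
have [e1|] := pselect (forall u v, g x u v = g' x u v); last by right; left.
have [e2|] := pselect (forall u v, h x u v = h' x u v); last by right; right.
left; split => // gh'; apply: ngh => u.
by rewrite /tensor_norm -e1 -e2; exact: gh'.
Qed.

Lemma Met_distE (g h : rough_metric) :
  Met_dist (\pi_Met g) (\pi_Met h) = rough_dist g h.
Proof.
have reprE k : ae_eq_metric (repr (\pi_Met k)) k.
  by rewrite -eqmodE reprK.
apply/eqP; rewrite eq_le /Met_dist.
by rewrite !le_rough_dist_ae_eq// ae_eq_metric_sym reprE.
Qed.

End rough_metric.

Section extended_metric.
Variables (R : realType) (T : Type) (d : T -> T -> \bar R).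
Local Open Scope ereal_scope.

Definition extended_metric : Prop :=
  [/\ forall x y, 0 <= d x y,
      forall x y, d x y = 0 <-> x = y,
      forall x y, d x y = d y x &
      forall x y z, d x z <= d x y + d y z].

Definition dist_cauchy (u : nat -> T) : Prop :=
  forall e : R, (0 < e)%R ->
    exists N, forall i j, (N <= i)%N -> (N <= j)%N -> d (u i) (u j) < e%:E.

Definition dist_cvg (u : nat -> T) (l : T) : Prop :=
  forall e : R, (0 < e)%R ->
    exists N, forall i, (N <= i)%N -> d (u i) l < e%:E.

Definition dist_complete : Prop :=
  forall u, dist_cauchy u -> exists l, dist_cvg u l.

(** Curves are parametrized by [0, 1]; values outside are irrelevant. *)
Definition continuous_curve (gamma : R -> T) : Prop :=
  forall s, (0 <= s <= 1)%R -> forall e : R, (0 < e)%R ->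
    exists2 r : R, (0 < r)%R & forall t, (0 <= t <= 1)%R ->
      (`|t - s| < r)%R -> d (gamma s) (gamma t) < e%:E.

Definition partition_length (gamma : R -> T) (s : seq R) : \bar R :=
  \sum_(0 <= k < size s)
    d (gamma (nth 1%R (0%R :: s) k)) (gamma (nth 1%R (0%R :: s) k.+1)).

Definition curve_length (gamma : R -> T) : \bar R :=
  ereal_sup [set partition_length gamma s | s in itv_partition 0%R 1%R].

Definition length_metric : Prop :=
  forall x y, d x y =
    ereal_inf [set curve_length gamma | gamma in
      [set gamma | [/\ continuous_curve gamma, gamma 0%R = x
                     & gamma 1%R = y]]].

Definition complete_extended_length_metric : Prop :=
  [/\ extended_metric, dist_complete & length_metric].

End extended_metric.

(* Main.v *)
Require Import Defs.
From HB Require Import structures.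
From mathcomp Require Import all_boot all_order all_algebra.
From mathcomp Require Import sesquilinear generic_quotient.
From mathcomp Require Import all_classical all_reals all_analysis.
From mathcomp Require Import measurable_realfun ring lra.
Import Order.TTheory GRing.Theory Num.Theory.
Import numFieldNormedType.Exports.

(** Everything is decided fibrewise. If [q] and [q'] are the quadratic forms of
    two rough metrics at a point, then [exp (-l) |u|' <= |u| <= exp l |u|']
    says that [q u] and [q' u] agree up to a factor [exp (2 l)] either way, so
    the distance is half the essential supremum over the points of the supremum
    over [u] of [|log (q u / q' u)|] ([rough_dist_le], [rough_dist_lt], [rough_dist_ge]). The two prerequisites
    are that null sets are stable under countable unions, and that the form of
    a rough metric is nonnegative almost everywhere ([ae_form_ge0]), which
    follows from local comparability by second countability. The axioms of an
    extended metric are then elementary, the separation axiom being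
    polarization.

    Completeness: along a Cauchy sequence, for almost every [x], the numbers
    [g_k(x)(u, u)] are Cauchy on a logarithmic scale uniformly in [u], hence
    converge; by polarization the forms converge. The limit, set to 0 where
    there is no convergence, is measurable because null sets are, and is
    comparable to the tails of the sequence, hence is a rough metric and the
    limit for the distance.

    Length: let [exp (-L) g <= h <= exp L g] almost everywhere as quadratic
    forms, with [L > 0]. Then [p = exp L g - h] and [q = h - exp (-L) g] are
    nonnegative forms, and [exp (-r) p + exp r q] is, up to the constant
    factor [2 sinh L], the form
      [(sinh (L - r) g + sinh r h) / sinh L],
    which runs from [g] at [r = 0] to [h] at [r = L]. Replacing [r] by [r']
    multiplies each of the two nonnegative summands by a factor between
    [exp (- |r - r'|)] and [exp |r - r'|], so the curve has length at most
    [L / 2], and the infimum of the admissible [L / 2] is the distance. This is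
    the chordal geodesic of the Thompson metric on a cone: its coefficients do
    not depend on the point, so, contrary to the fibrewise matrix geodesic
    [t |-> g (g^-1 h)^t], it needs no spectral calculus and is measurable for
    trivial reasons. *)

Set Implicit Arguments.
Unset Strict Implicit.
Unset Printing Implicit Defensive.

Local Open Scope classical_set_scope.
Local Open Scope ring_scope.

Local Notation ae := (Defs.almost_everywhere setT).

(** * Comparison of real numbers up to a factor [exp l] *)

Section log_close.
Variable R : realType.
Implicit Types a b c l m L s t : R.

(** For positive numbers this is [|ln a - ln b| <= l]; the multiplicative form
    makes sense, and is still transitive, for all reals. *)
Definition log_close l a b : Prop := expR (- l) * b <= a <= expR l * b.

Lemma log_close_sym l a b : log_close l a b -> log_close l b a.
Proof.
rewrite /log_close => /andP[ba ab].
by rewrite expRN ler_pdivrMl ?expR_gt0// ab -ler_pdivrMl ?expR_gt0// -expRN.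
Qed.

Lemma log_close_trans l m a b c :
  log_close l a b -> log_close m b c -> log_close (l + m) a c.
Proof.
move=> /andP[ba ab] /andP[cb bc]; rewrite /log_close opprD !expRD -!mulrA.
apply/andP; split.
  by apply: le_trans ba; rewrite ler_wpM2l ?expR_ge0.
by apply: le_trans ab _; rewrite ler_wpM2l ?expR_ge0.
Qed.

Lemma log_close_widen l m a b :
  0 <= b -> l <= m -> log_close l a b -> log_close m a b.
Proof.
move=> b0 lm /andP[ba ab]; apply/andP; split.
  by apply: le_trans ba; rewrite ler_wpM2r// ler_expR lerN2.
by apply: le_trans ab _; rewrite ler_wpM2r// ler_expR.
Qed.

Lemma log_closeZ c l a b : 0 <= c -> log_close l a b ->
  log_close l (c * a) (c * b).
Proof.
move=> c0 /andP[ba ab]; rewrite /log_close !(mulrCA _ c).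
by apply/andP; split; rewrite ler_wpM2l.
Qed.

Lemma log_close_ge0 l a b : 0 <= b -> log_close l a b -> 0 <= a.
Proof.
by move=> b0 /andP[+ _]; apply: le_trans; rewrite mulr_ge0 ?expR_ge0.
Qed.

(** Passing between norms and quadratic forms halves the logarithmic scale. *)
Lemma log_close_sqrt l a b : 0 <= a -> 0 <= b ->
  log_close l (Num.sqrt a) (Num.sqrt b) <-> log_close (l + l) a b.
Proof.
move=> a0 b0.
have E k : expR k * Num.sqrt b = Num.sqrt (expR (k + k) * b).
  by rewrite sqrtrM ?expR_ge0// expRD -expr2 sqrtr_sqr ger0_norm ?expR_ge0.
by rewrite /log_close !E !ler_sqrt ?mulr_ge0 ?expR_ge0// opprD.
Qed.

Lemma log_close_eq a b :
  (forall k, log_close k.+1%:R^-1 a b) -> a = b.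
Proof.
have le_of (x y : R) : (forall k, x <= expR (k.+1%:R^-1) * y) -> x <= y.
  move=> xy.
  have cy : (fun k => expR (k.+1%:R^-1) * y) @ \oo --> y.
    have cE : (fun k => expR (k.+1%:R^-1)) @ \oo --> expR (0 : R).
      apply: continuous_cvg; first exact: continuous_expR.
      exact: cvg_harmonic.
    by rewrite -[X in _ --> X]mul1r -[X in X * _]expR0; exact: cvgMl.
  rewrite -(cvg_lim _ cy)//; apply: limr_ge; first exact: cvgP cy.
  exact: nearW.
move=> ab; apply/eqP; rewrite eq_le; apply/andP; split; apply: le_of => k.
  by have /andP[] := ab k.
by have /log_close_sym/andP[] := ab k.
Qed.

(** Closeness to one fixed term bounds the sequence; on bounded sequences
    factors close to 1 are small additive errors. Working
    without logarithms allows terms equal to 0. *)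
Lemma log_close_cauchy_cvg (a : nat -> R) : (forall k, 0 <= a k) ->
  (forall j, exists N, forall i k, (N <= i)%N -> (N <= k)%N ->
     log_close j.+1%:R^-1 (a i) (a k)) ->
  cvgn a.
Proof.
move=> a0 ac; apply/cauchy_cvgP/cauchy_exP => e e0.
have [N0 aN0] := ac 0%N.
pose m := expR 1 * a N0.
have m0 : 0 <= m by rewrite mulr_ge0 ?expR_ge0.
have am k : (N0 <= k)%N -> a k <= m.
  by move=> Nk; have /andP[_] := aN0 k N0 Nk (leqnn _); rewrite invr1.
(* [m + 1] rather than [m], which may be 0; the error factor is [1 + q]. *)
pose q := e / (m + 1).
have q0 : 0 < q by rewrite divr_gt0// ltr_wpDl.
have l0 : 0 < ln (1 + q) by rewrite ln_gt0// ltrDl.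
have [j _ jl] := near_infty_natSinv_lt (PosNum l0).
have {}jl : j.+1%:R^-1 <= ln (1 + q) by apply/ltW/(jl j) => /=.
have qE : expR (ln (1 + q)) = 1 + q by rewrite lnK// posrE addr_gt0.
have [N1 aN1] := ac j.
pose N := maxn N0 N1.
exists (a N), N => // i /= Ni; rewrite -ball_normE/=.
have aN := am N (leq_maxl _ _).
have /(log_close_widen (a0 N) jl) : log_close j.+1%:R^-1 (a i) (a N).
  by apply: aN1; rewrite ?leq_maxr// (leq_trans (leq_maxr _ _) Ni).
rewrite /log_close expRN qE ler_pdivrMl ?addr_gt0// => /andP[lo hi].
have qa : q * a N < e.
  rewrite /q mulrAC ltr_pdivrMr ?ltr_wpDl// ltr_pM2l//; lra.
have qi : q * a N >= 0 by rewrite mulr_ge0// ltW.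
rewrite ltr_norml; apply/andP; split; first lra.
have [?|ai] := leP (a N) (a i); first lra.
have : q * a i <= q * a N by rewrite ler_pM2l// ltW.
lra.
Qed.

Lemma log_close_lim l (a : nat -> R) b N : cvgn a ->
  (forall k, (N <= k)%N -> log_close l (a k) b) -> log_close l (limn a) b.
Proof.
move=> ca ab; apply/andP; split.
  by apply: limr_ge => //; exists N => // k /= /ab /andP[].
by apply: limr_le => //; exists N => // k /= /ab /andP[].
Qed.

(** The main estimate behind the length property: with [p = exp L a - b] and
    [q = b - exp (- L) a], both nonnegative, the combinations below are
    [exp (- t) p + exp t q] and [exp (- s) p + exp s q], which are compared
    term by term. *)
Lemma log_close_sinh L s t a b : log_close L b a ->
  log_close `|t - s|
    ((expR (L - t) - expR (t - L)) * a + (expR t - expR (- t)) * b)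
    ((expR (L - s) - expR (s - L)) * a + (expR s - expR (- s)) * b).
Proof.
move=> /andP[ab ba].
pose p := expR L * a - b; pose q := b - expR (- L) * a.
have E r : (expR (L - r) - expR (r - L)) * a + (expR r - expR (- r)) * b =
    expR (- r) * p + expR r * q.
  by rewrite /p /q !expRD; ring.
have p0 : 0 <= p by rewrite subr_ge0.
have q0 : 0 <= q by rewrite subr_ge0.
rewrite !E /log_close; clearbody p q.
rewrite !mulrDr !mulrA -!expRD; apply/andP; split.
  apply: lerD; rewrite ler_wpM2r// ler_expR.
    have := ler_norm (t - s); lra.
  have := ler_norm (s - t); rewrite distrC; lra.
apply: lerD; rewrite ler_wpM2r// ler_expR.
  have := ler_norm (s - t); rewrite distrC; lra.
have := ler_norm (t - s); lra.
Qed.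

End log_close.

(** * Symmetric bilinear forms *)

Section sym_form.
Variables (R : realType) (V : lmodType R).
Implicit Types (B : {symmetric V}) (u v w : V).

Lemma sym_formC B u v : B u v = B v u.
Proof. by rewrite hermC expr0 mul1r. Qed.

Lemma polarization B u v :
  B u v = 2^-1 * (B (u + v) (u + v) - B u u - B v v).
Proof.
rewrite hnormD /= expr0 mul1r; lra.
Qed.

Section build.
Variables (f : V -> V -> R)
  (f_linear : forall a u w v, f (a *: u + w) v = a * f u v + f w v)
  (f_sym : forall u v, f u v = f v u).

(** An alias of [f] recording the proofs, on which the canonical structures can
    be declared. *)
Definition form_of of (forall a u w v, f (a *: u + w) v = a * f u v + f w v)
  & (forall u v, f u v = f v u) := f.

Lemma form_of_bilinear : bilinear_for *%R *%R (form_of f_linear f_sym).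
Proof.
split=> u a v w /=; first exact: f_linear.
by rewrite /form_of f_sym f_linear f_sym (f_sym w).
Qed.

Lemma form_of_hermitian u v :
  form_of f_linear f_sym u v = (-1) ^+ false * form_of f_linear f_sym v u.
Proof. by rewrite mul1r; exact: f_sym. Qed.

HB.instance Definition _ := bilinear_isBilinear.Build R V V R *%R *%R
  (form_of f_linear f_sym) form_of_bilinear.
HB.instance Definition _ := isHermitianSesquilinear.Build R V false idfun
  (form_of f_linear f_sym) form_of_hermitian.

Definition sym_form : {symmetric V} := form_of f_linear f_sym.

Lemma sym_formE u v : sym_form u v = f u v.
Proof. by []. Qed.

End build.

End sym_form.

(** * Null sets of a manifold *)

Section null_sets.
Variables (R : realType) (n : nat) (M : smooth_manifold R n).
Implicit Types (Z : set M) (P Q : M -> Prop).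

Lemma measure_zero_bigcup (Z : nat -> set M) :
  (forall k, measure_zero (Z k)) -> measure_zero (\bigcup_k Z k).
Proof.
move=> Z0 c ac; apply/eqP; rewrite eq_le lebesgue_outer_ge0 andbT.
rewrite setI_bigcupl image_bigcup.
apply: le_trans (outer_measure_sigma_subadditive _ _) _.
by rewrite eseries0// => k _ _; exact: Z0.
Qed.

Lemma ae_sub P Q :
  (forall x, P x -> Q x) -> ae P -> ae Q.
Proof.
by move=> PQ; apply: sub_measure_zero => x [_ nQ]; split => // /PQ.
Qed.

Lemma ae_and P Q :
  ae P -> ae Q ->
  ae (fun x => P x /\ Q x).
Proof.
move=> aP aQ; apply: sub_measure_zero (measure_zeroU aP aQ) => x [_ nPQ].
by have [Px|nPx] := pselect (P x); [right; split => // Qx; exact: nPQ|left].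
Qed.

Lemma ae_forall (P : nat -> M -> Prop) :
  (forall k, ae (P k)) ->
  ae (fun x => forall k, P k x).
Proof.
move=> aP; apply: sub_measure_zero (measure_zero_bigcup aP) => x [_].
by move/existsNP => [k nP]; exists k.
Qed.

(** A countable basis reduces the union of the local exceptional sets to a
    countable one. *)
Lemma ae_local P :
  (forall x, exists2 U : set M, open U /\ U x & Defs.almost_everywhere U P) ->
  ae P.
Proof.
move=> locP; have [B /countable_injP[f f_inj] [Bo Bnbhs]] :=
  manifold_second_countable M.
(* [f] is injective on the basis [B], so at most one [W] is good for [k]. *)
pose good k W := [/\ B W, f W = k & Defs.almost_everywhere W P].
pose Z k := [set x | ~ P x /\ exists2 W, good k W & W x].
apply: (@sub_measure_zero _ _ _ _ (\bigcup_k Z k)).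
  move=> x [_ nP]; have [U [Uo Ux] aU] := locP x.
  have [W [BW Wx] WU] : filter_from [set W | B W /\ W x] id U.
    by apply: Bnbhs; exact: open_nbhs_nbhs.
  exists (f W) => //; split => //; exists W => //; split => //.
  by apply: sub_measure_zero aU => y [Wy nPy]; split => //; exact: WU.
apply: measure_zero_bigcup => k.
have [[W [BW fW aW]]|noW] := pselect (exists W, good k W).
  apply: sub_measure_zero aW => x [nP [W' [BW' fW' _] W'x]].
  by split => //; rewrite (f_inj W W')// ?inE// fW fW'.
apply: sub_measure_zero (@measure_zero_set0 _ _ _) => x [_ [W gW _]].
by apply: noW; exists W.
Qed.

(** Lebesgue measure is complete: the exceptional set, read in a chart, has
    outer measure zero, hence is measurable. *)
Lemma ae_measurable (c : chart R n M) P : atlas c ->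
  ae P -> measurable (crange c : set (lebesgue_rV R n)) ->
  measurable ([set p | crange c p /\ P (cinv c p)] : set (lebesgue_rV R n)).
Proof.
move=> ac aP mc.
pose Z : set (lebesgue_rV R n) :=
  cmap c @` ([set x | setT x /\ ~ P x] `&` cdom c).
have mZ : measurable Z.
  apply: le_caratheodory_measurable => X.
  have -> : (@lebesgue_outer R n : {outer_measure set _ -> \bar R})
      (X `&` Z) = 0%E.
    apply/eqP; rewrite eq_le lebesgue_outer_ge0 andbT -(aP c ac).
    by apply: le_lebesgue_outer => ? [].
  by rewrite add0e; apply: le_lebesgue_outer => ? [].
rewrite (_ : [set p | _] = crange c `\` Z); first exact: measurableD.
apply/seteqP; split => [p [[x cx <-]]|p [[x cx <-] nZ]].
  rewrite cmapK// => Px; split; first by exists x.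
  by case=> y [[_ nPy] cy] xy; apply: nPy; rewrite -(cmapK cy) xy cmapK.
split; first by exists x.
by rewrite cmapK//; apply: contrapT => nPx; apply: nZ; exists x.
Qed.

End null_sets.

(** * The distance in terms of quadratic forms *)

Section rough_metrics.
Variables (R : realType) (n : nat) (M : smooth_manifold R n).
Implicit Types (g h : rough_metric M) (x : M) (l : R).

Lemma pullback_norm_eq0 (c : chart R n M) x (u : tangent x) :
  atlas c -> cdom c x -> pullback_norm c u = 0 -> u = 0.
Proof.
move=> ac cx /eqP; rewrite sqrtr_eq0 => u_le0.
have /eqP : \sum_i (tangent_coord c u ord0 i) ^+ 2 = 0.
  by apply/eqP; rewrite eq_le u_le0 sumr_ge0// => i _; exact: sqr_ge0.
rewrite psumr_eq0 => [/allP u0|i _]; last exact: sqr_ge0.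
have {u_le0 u0} : tangent_coord c u = 0.
  apply/rowP => i; rewrite mxE; apply/eqP.
  by have := u0 i (mem_index_enum i); rewrite sqrf_eq0.
rewrite /tangent_coord; case: pselect => [cx'|[]//] uc0.
apply: val_inj; apply/funext => c' /=.
have /asboolP/(_ (exist _ c cx') c') -> := tangent_valP u.
by rewrite uc0 linear0.
Qed.

(** If [g x u u < 0] then [|u|_g = 0], as square roots of negative numbers are
    0, and the lower bound by the Euclidean norm of a chart forces [u = 0]. *)
Lemma ae_form_ge0 g : ae (fun x => forall u, 0 <= g x u u).
Proof.
apply: ae_local => x.
have [c [ac cx [C C1 cmp]]] := rough_comparable g x.
exists (cdom c); first by split => //; exact: cdom_open.
apply: sub_measure_zero cmp => y [cy nP]; split => // cmpy; apply: nP => u.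
rewrite leNgt; apply/negP => gu.
have /andP[+ _] := cmpy u.
rewrite /tensor_norm ler0_sqrtr ?(ltW gu)// pmulr_rle0 ?invr_gt0; last first.
  exact: lt_le_trans C1.
move=> pu; have u0 : u = 0.
  apply: (pullback_norm_eq0 ac cy); apply/eqP.
  by rewrite eq_le pu sqrtr_ge0.
by move: gu; rewrite u0 linear0 ltxx.
Qed.

(** The comparison that is used for quadratic forms instead of norms, whence
    [l + l] below. *)
Definition forms_close l (g h : tensor_field M) x : Prop :=
  forall u, log_close l (g x u u) (h x u u).

Lemma forms_close_sym l (g h : tensor_field M) x :
  forms_close l g h x -> forms_close l h g x.
Proof. by move=> gh u; apply/log_close_sym. Qed.

Lemma equivalent_by_expR l g h :
  equivalent_by (expR l) g h <-> ae (forms_close (l + l) g h).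
Proof.
have gh0 := ae_and (ae_form_ge0 g) (ae_form_ge0 h).
rewrite /equivalent_by -expRN; split=> gh; apply: ae_sub (ae_and gh0 gh);
  move=> x [[g0 h0] ghx] u; have := ghx u.
  by move/(log_close_sqrt _ (g0 u) (h0 u)).
by move/(log_close_sqrt _ (g0 u) (h0 u)).
Qed.

Lemma forms_close_locally_comparable l g (h : tensor_field M) : 0 <= l ->
  ae (forms_close (l + l) h g) -> locally_comparable h.
Proof.
move=> l0 hg x; have [c [ac cx [C C1 cmp]]] := rough_comparable g x.
have e1 : 1 <= expR l by rewrite -(expR0 R) ler_expR.
exists c; split => //; exists (expR l * C).
  by rewrite -[1]mulr1 ler_pM.
apply: sub_measure_zero (measure_zeroU cmp (ae_and hg (ae_form_ge0 g))).
move=> y [cy nP].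
have [cmpy|] := pselect (forall u : tangent y,
  C^-1 * pullback_norm c u <= tensor_norm g u <= C * pullback_norm c u);
  last by left.
right; split => // -[hgy g0]; apply: nP => u.
have /(log_close_sqrt _ (log_close_ge0 (g0 u) (hgy u)) (g0 u)) := hgy u.
move=> /andP[gh hg']; have /andP[pg gp] := cmpy u.
rewrite invfM -expRN -!mulrA; apply/andP; split.
  by apply: le_trans gh; rewrite ler_wpM2l ?expR_ge0.
by apply: le_trans hg' _; rewrite ler_wpM2l ?expR_ge0.
Qed.

Lemma rough_dist_le l g h : 0 <= l ->
  ae (forms_close (l + l) g h) -> (rough_dist g h <= l%:E)%E.
Proof.
move=> l0 /equivalent_by_expR gh; apply: ereal_inf_lbound.
exists (expR l); last by rewrite expRK.
by split => //=; rewrite -(expR0 R) ler_expR.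
Qed.

(** A constant below [l] in the set defining the infimum can be enlarged to [l]
    because the forms are nonnegative almost everywhere. *)
Lemma rough_dist_lt l g h : (rough_dist g h < l%:E)%E ->
  0 < l /\ ae (forms_close (l + l) g h).
Proof.
move=> /ereal_inf_lt[_ [C [C1 gh] <-]]; rewrite lte_fin => Cl.
have C0 : 0 < C by exact: lt_le_trans C1.
split; first exact: le_lt_trans (ln_ge0 C1) Cl.
move: gh; rewrite -{1}(@lnK _ C) ?posrE// => /equivalent_by_expR gh.
apply: ae_sub (ae_and gh (ae_form_ge0 h)) => x [ghx h0] u.
by apply: log_close_widen (ghx u) => //; rewrite lerD// ltW.
Qed.

Lemma rough_dist_ge g h (d : \bar R) :
  (forall l, 0 <= l -> ae (forms_close (l + l) g h) -> (d <= l%:E)%E) ->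
  (d <= rough_dist g h)%E.
Proof.
move=> dle; apply: le_ereal_inf_tmp => _ [C [C1 gh] <-].
apply: dle; first exact: ln_ge0.
by apply/equivalent_by_expR; rewrite lnK// posrE (lt_le_trans _ C1).
Qed.

Lemma rough_dist_ge0 g h : (0 <= rough_dist g h)%E.
Proof. by apply: rough_dist_ge => l l0 _; rewrite lee_fin. Qed.

Lemma rough_dist_sym g h : rough_dist g h = rough_dist h g.
Proof.
suff le g' h' : (rough_dist g' h' <= rough_dist h' g')%E.
  by apply/eqP; rewrite eq_le !le.
apply: rough_dist_ge => l l0 hg; apply: rough_dist_le => //.
by apply: ae_sub hg => x; exact: forms_close_sym.
Qed.

Lemma rough_dist_triangle g h k :
  (rough_dist g k <= rough_dist g h + rough_dist h k)%E.
Proof.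
have gk_le l : 0 <= l -> ae (forms_close (l + l) h k) ->
    (rough_dist g k <= rough_dist g h + l%:E)%E.
  move=> l0 hk; rewrite -leeBlDr//; apply: rough_dist_ge => m m0 gh.
  rewrite leeBlDr// -EFinD; apply: rough_dist_le; first exact: addr_ge0.
  apply: ae_sub (ae_and gh hk) => x [ghx hkx] u.
  by rewrite addrACA; exact: log_close_trans (ghx u) (hkx u).
have [->|gh_oo] := eqVneq (rough_dist g h) +oo%E.
  by rewrite addye ?leey// gt_eqF// (lt_le_trans _ (rough_dist_ge0 _ _)).
have gh_fin : rough_dist g h \is a fin_num.
  by rewrite ge0_fin_numE ?rough_dist_ge0// ltey.
rewrite -leeBlDl//; apply: rough_dist_ge => l l0 hk.
by rewrite leeBlDl//; exact: gk_le.
Qed.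

Lemma rough_dist_eq0 g h : rough_dist g h = 0%E <-> ae_eq_metric g h.
Proof.
split=> [gh0|/asboolP gh].
  have gh j : ae (forms_close j.+1%:R^-1 g h).
    have j0 : 0 < j.+1%:R^-1 / 2 :> R by rewrite divr_gt0 ?invr_gt0.
    have [|_] := @rough_dist_lt (j.+1%:R^-1 / 2) g h.
      by rewrite gh0 lte_fin.
    by rewrite -splitr.
  apply/asboolP; apply: ae_sub (ae_forall gh) => x ghx u v.
  have E w : g x w w = h x w w by apply: log_close_eq => j; exact: ghx.
  by rewrite (polarization (g x) u) (polarization (h x) u) !E.
apply/eqP; rewrite eq_le rough_dist_ge0 andbT; apply: rough_dist_le => //.
apply: ae_sub gh => x gh u.
by rewrite gh /log_close addr0 oppr0 expR0 mul1r lexx.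
Qed.

End rough_metrics.

(** * Combinations and limits of tensor fields *)

Section combination.
Variables (R : realType) (n : nat) (M : smooth_manifold R n).

Section form.
Variables (V : lmodType R) (B B' : {symmetric V}) (a b : R).

Let comb u v := a * B u v + b * B' u v.

Lemma comb_linear c u w v : comb (c *: u + w) v = c * comb u v + comb w v.
Proof. by rewrite /comb !linearPl /=; ring. Qed.

Lemma comb_sym u v : comb u v = comb v u.
Proof. by rewrite /comb !(sym_formC _ u). Qed.

Definition comb_form : {symmetric V} := sym_form comb_linear comb_sym.

End form.

Definition comb_tensor (g h : tensor_field M) (a b : R) : tensor_field M :=
  fun x => comb_form (g x) (h x) a b.

Lemma comb_tensorE g h a b (x : M) (u v : tangent x) :
  comb_tensor g h a b x u v = a * g x u v + b * h x u v.
Proof. by []. Qed.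

Lemma measurable_comb_tensor (g h : tensor_field M) a b :
  measurable_tensor g -> measurable_tensor h ->
  measurable_tensor (comb_tensor g h a b).
Proof.
move=> mg mh c ac i j.
by apply: measurable_funD; apply: measurable_funM => //; [exact: mg|exact: mh].
Qed.

End combination.

(** Measurability of the range of a chart comes for free, since
    [measurable_fun D f] presupposes it of [D]. *)
Lemma measurable_fun_of_measurable d d'
    (T : measurableType d) (T' : measurableType d')
    (D : set T) (f : T -> T') :
  (measurable D -> measurable_fun D f) -> measurable_fun D f.
Proof. by move=> mf mD; exact: mf. Qed.

Section limit.
Variables (R : realType) (n : nat) (M : smooth_manifold R n).
Variable g : nat -> tensor_field M.

Definition forms_cvg (x : M) : Prop := forall u v, cvgn (fun k => g k x u v).

Let limit (x : M) (u v : tangent x) : R :=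
  if `[< forms_cvg x >] then limn (fun k => g k x u v) else 0.

Lemma limit_linear (x : M) a (u w v : tangent x) :
  limit (a *: u + w) v = a * limit u v + limit w v.
Proof.
rewrite /limit; case: asboolP => [gx|_]; last by rewrite mulr0 addr0.
have -> : (fun k => g k x (a *: u + w) v) =
    (fun k => a * g k x u v + g k x w v).
  by apply/funext => k; rewrite linearPl.
by apply/cvg_lim => //; apply: cvgD; [apply: cvgMr|]; exact: gx.
Qed.

Lemma limit_sym (x : M) (u v : tangent x) : limit u v = limit v u.
Proof.
rewrite /limit; case: asboolP => // _; congr (limn _).
by apply/funext => k; exact: sym_formC.
Qed.

Definition limit_tensor : tensor_field M :=
  fun x => sym_form (@limit_linear x) (@limit_sym x).

Lemma limit_tensorE (x : M) (u v : tangent x) : forms_cvg x ->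
  limit_tensor x u v = limn (fun k => g k x u v).
Proof. by move=> gx; rewrite sym_formE /limit; case: asboolP. Qed.

Lemma limit_tensor_dvg (x : M) (u v : tangent x) : ~ forms_cvg x ->
  limit_tensor x u v = 0.
Proof. by move=> gx; rewrite sym_formE /limit; case: asboolP. Qed.

(** Cutting each [g k] off outside the measurable set where the sequence
    converges gives a sequence converging everywhere to the limit tensor. *)
Lemma measurable_limit_tensor : ae forms_cvg ->
  (forall k, measurable_tensor (g k)) -> measurable_tensor limit_tensor.
Proof.
move=> ae_cvg mg c ac i j; apply: measurable_fun_of_measurable => mc.
pose A : set (lebesgue_rV R n) := [set p | crange c p /\ forms_cvg (cinv c p)].
have mA : measurable A by exact: ae_measurable.
apply: (@measurable_fun_cvg _ (lebesgue_rV R n) R _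
    (fun k => tensor_coef (g k) c i j \* (\1_A : lebesgue_rV R n -> R))).
  move=> k; apply: measurable_funM; first exact: mg.
  exact: measurable_indic.
move=> p cp; rewrite /tensor_coef /= indicE.
have [gp|ngp] := pselect (forms_cvg (cinv c p)).
  rewrite limit_tensorE//; have -> : p \in A by rewrite inE.
  under eq_fun do rewrite mulr1.
  exact: gp.
have /negbTE -> : p \notin A by apply/negP; rewrite inE => -[].
rewrite limit_tensor_dvg//.
by under eq_fun do rewrite mulr0; exact: cvg_cst.
Qed.

End limit.

(** * Completeness *)

Section complete.
Variables (R : realType) (n : nat) (M : smooth_manifold R n).
Variable g : nat -> rough_metric M.
Hypothesis g_cauchy : dist_cauchy (@rough_dist R n M) g.

Lemma cauchy_ae_forms_close l : 0 < l -> exists N, ae (fun x =>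
  forall i k, (N <= i)%N -> (N <= k)%N -> forms_close (l + l) (g i) (g k) x).
Proof.
move=> /g_cauchy[N gN]; exists N.
apply: ae_forall => i; apply: ae_forall => k.
have [Ni|iN] := leqP N i; last first.
  by apply: sub_measure_zero (@measure_zero_set0 _ _ _) => x [_ []].
have [Nk|kN] := leqP N k; last first.
  by apply: sub_measure_zero (@measure_zero_set0 _ _ _) => x [_ []].
by have [_] := rough_dist_lt (gN i k Ni Nk); apply: ae_sub => x.
Qed.

Lemma cauchy_ae_forms_cvg : ae (forms_cvg g).
Proof.
have ae_close : ae (fun x => forall j, exists N, forall i k,
    (N <= i)%N -> (N <= k)%N -> forms_close j.+1%:R^-1 (g i) (g k) x).
  apply: ae_forall => j.
  have j0 : 0 < j.+1%:R^-1 / 2 :> R by rewrite divr_gt0 ?invr_gt0.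
  have [N] := cauchy_ae_forms_close j0; apply: ae_sub => x gx.
  by exists N => i k Ni Nk; rewrite [j.+1%:R^-1]splitr; exact: gx.
have ae_ge0 := ae_forall (fun k => ae_form_ge0 (g k)).
apply: ae_sub (ae_and ae_close ae_ge0) => x [gx g0].
have gw w : cvgn (fun k => g k x w w).
  apply: log_close_cauchy_cvg => [k|j]; first exact: g0.
  by have [N gN] := gx j; exists N => i k Ni Nk; exact: gN.
move=> u v; rewrite (_ : (fun k => _) = fun k =>
    2^-1 * (g k x (u + v) (u + v) - g k x u u - g k x v v)); last first.
  by apply/funext => k; exact: polarization.
by apply: is_cvgMr; apply: is_cvgB => //; apply: is_cvgB.
Qed.

Lemma ae_forms_close_limit l : 0 < l -> exists N, forall k, (N <= k)%N ->
  ae (forms_close (l + l) (limit_tensor g) (g k)).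
Proof.
move=> /cauchy_ae_forms_close[N gN]; exists N => k Nk.
apply: ae_sub (ae_and gN cauchy_ae_forms_cvg) => x [gx cx] u.
rewrite limit_tensorE//; apply: (@log_close_lim _ _ _ _ N) => // i Ni.
exact: gx.
Qed.

Lemma rough_dist_complete : exists h, dist_cvg (@rough_dist R n M) g h.
Proof.
have mlim : measurable_tensor (limit_tensor g).
  apply: measurable_limit_tensor; first exact: cauchy_ae_forms_cvg.
  by move=> k; exact: rough_measurable.
have [N gN] := ae_forms_close_limit ltr01.
(* Any tail of the sequence shows that the limit is locally comparable. *)
pose h := RoughMetric mlim
  (forms_close_locally_comparable ler01 (gN N (leqnn N))).
exists h => e e0.
have [N' gN'] := ae_forms_close_limit (divr_gt0 e0 (ltr0Sn _ 1)).
exists N' => k N'k; apply: (@le_lt_trans _ _ (e / 2)%:E); last first.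
  by rewrite lte_fin ltr_pdivrMr// ltr_pMr// ltr1n.
rewrite rough_dist_sym; apply: rough_dist_le; first by rewrite divr_ge0// ltW.
exact: gN'.
Qed.

End complete.

(** * Geodesics and lengths of curves *)

Section geodesic.
Variables (R : realType) (n : nat) (M : smooth_manifold R n).
Variables (g h : rough_metric M) (l : R).
Hypotheses (l_gt0 : 0 < l) (gh : ae (forms_close (l + l) g h)).

Let L := l + l.
(* [weight r = sinh r / sinh L]. *)
Let weight r := (expR r - expR (- r)) / (expR L - expR (- L)).

Definition geodesic_tensor s : tensor_field M :=
  comb_tensor g h (weight (L - L * s)) (weight (L * s)).

Let L_gt0 : 0 < L. Proof. by rewrite addr_gt0. Qed.

Let sinhL_gt0 : 0 < expR L - expR (- L).
Proof. by rewrite subr_gt0 ltr_expR gtrN. Qed.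

Lemma geodesic_tensor0 x u v : geodesic_tensor 0 x u v = g x u v.
Proof.
rewrite comb_tensorE /weight mulr0 subr0 oppr0 subrr mul0r mul0r addr0.
by rewrite divff ?mul1r// gt_eqF.
Qed.

Lemma geodesic_tensor1 x u v : geodesic_tensor 1 x u v = h x u v.
Proof.
rewrite comb_tensorE /weight mulr1 subrr oppr0 subrr mul0r mul0r add0r.
by rewrite divff ?mul1r// gt_eqF.
Qed.

Lemma geodesic_tensor_close s t :
  ae (forms_close (l * `|s - t| + l * `|s - t|)
    (geodesic_tensor s) (geodesic_tensor t)).
Proof.
apply: ae_sub gh => x ghx u.
have /(log_close_sinh (L * t) (L * s)) := log_close_sym (ghx u).
rewrite -mulrBr normrM (gtr0_norm L_gt0) {1}/L mulrDl.
have inv0 : 0 <= (expR L - expR (- L))^-1 by rewrite invr_ge0 ltW.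
move/(log_closeZ inv0).
rewrite !comb_tensorE /weight !opprB.
by congr log_close; ring.
Qed.

Lemma geodesic_measurable s : measurable_tensor (geodesic_tensor s).
Proof. by apply: measurable_comb_tensor; exact: rough_measurable. Qed.

(** The curve stays at finite distance from its starting point. *)
Lemma geodesic_comparable s : locally_comparable (geodesic_tensor s).
Proof.
apply: (@forms_close_locally_comparable _ _ _ (l * `|s - 0|) g).
  by rewrite mulr_ge0// ltW.
apply: ae_sub (geodesic_tensor_close s 0) => x + u => /(_ u).
by rewrite geodesic_tensor0.
Qed.

Definition geodesic s : rough_metric M :=
  RoughMetric (geodesic_measurable s) (geodesic_comparable s).

Lemma geodesic_lipschitz s t :
  (rough_dist (geodesic s) (geodesic t) <= (l * `|s - t|)%:E)%E.
Proof.
apply: rough_dist_le; first by rewrite mulr_ge0// ltW.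
exact: geodesic_tensor_close.
Qed.

Lemma geodesic0 : ae_eq_metric (geodesic 0) g.
Proof.
apply/asboolP; apply: sub_measure_zero (@measure_zero_set0 _ _ _) => x [_ []].
exact: geodesic_tensor0.
Qed.

Lemma geodesic1 : ae_eq_metric (geodesic 1) h.
Proof.
apply/asboolP; apply: sub_measure_zero (@measure_zero_set0 _ _ _) => x [_ []].
exact: geodesic_tensor1.
Qed.

End geodesic.

Section curves.
Variables (R : realType) (T : Type) (d : T -> T -> \bar R).
Implicit Types (gamma : R -> T) (l : R).

Lemma dist_le_curve_length gamma :
  (d (gamma 0%R) (gamma 1%R) <= curve_length d gamma)%E.
Proof.
apply: ereal_sup_ubound; exists [:: 1]; first exact: itv_partition1.
by rewrite /partition_length big_nat1.
Qed.

Section lipschitz.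
Variables (gamma : R -> T) (l : R).
Hypothesis gamma_lip : forall s t,
  (d (gamma s) (gamma t) <= (l * `|s - t|)%R%:E)%E.

Lemma lipschitz_continuous_curve : 0 < l -> continuous_curve d gamma.
Proof.
move=> l0 s _ e e0; exists (e / l); first exact: divr_gt0.
move=> t _ ts; apply: le_lt_trans (gamma_lip s t) _.
by rewrite lte_fin mulrC -ltr_pdivlMr// distrC.
Qed.

Lemma lipschitz_curve_length : (curve_length d gamma <= l%:E)%E.
Proof.
apply: ub_ereal_sup => _ [s [s_path /eqP s_last] <-].
rewrite /partition_length -[l]mulr1 -[X in (_ * X)%:E](subr0 1) -{3}s_last.
elim: s 0 s_path {s_last} => [a _|b s IHs a /= /andP[ab bs]].
  by rewrite big_nil /= subrr mulr0.
rewrite big_nat_recl//=.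
have -> : l * (last b s - a) = l * `|a - b| + l * (last b s - b).
  by rewrite distrC gtr0_norm ?subr_gt0//; ring.
by rewrite EFinD; apply: leeD; [exact: gamma_lip|exact: IHs].
Qed.

End lipschitz.

End curves.

Local Open Scope quotient_scope.

Theorem theorem2p4 (R : realType) (n : nat) (M : smooth_manifold R n)
    (M_connected : connected (@setT M)) :
  complete_extended_length_metric (@Met_dist R n M).
Proof.
split; first split => [g h|g h|g h|g h k].
- exact: rough_dist_ge0.
- rewrite /Met_dist; split=> [/rough_dist_eq0|->].
    2: exact/rough_dist_eq0/ae_eq_metric_refl.
  by rewrite -{2}(reprK g) -{2}(reprK h) => /eqmodP.
- exact: rough_dist_sym.
- exact: rough_dist_triangle.
- move=> u u_cauchy; have [h uh] := rough_dist_complete u_cauchy.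
  exists (\pi_(Met M) h) => e /uh[N uN]; exists N => i Ni.
  by rewrite -(reprK (u i)) Met_distE; exact: uN.
- move=> g h; apply/eqP; rewrite eq_le; apply/andP; split.
    apply: le_ereal_inf_tmp => _ [gamma [_ <- <-] <-].
    exact: dist_le_curve_length.
  (* The geodesic needs a positive bound, while [l] may be 0. *)
  apply: rough_dist_ge => l l0 gh; apply/lee_addgt0Pr => e e0; rewrite -EFinD.
  have le0 : 0 < l + e by exact: ltr_wpDl.
  have {}gh : ae (forms_close ((l + e) + (l + e)) (repr g) (repr h)).
    apply: ae_sub (ae_and gh (ae_form_ge0 (repr h))) => x [ghx h0] u.
    by apply: log_close_widen (ghx u) => //; rewrite lerD// lerDl ltW.
  pose gamma s := \pi_(Met M) (geodesic le0 gh s).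
  have gamma_lip s t :
      (Met_dist (gamma s) (gamma t) <= ((l + e) * `|s - t|)%:E)%E.
    by rewrite Met_distE; exact: geodesic_lipschitz.
  apply: le_trans (lipschitz_curve_length gamma_lip).
  apply: ereal_inf_lbound; exists gamma => //; split.
  + exact: lipschitz_continuous_curve gamma_lip le0.
  + by rewrite -[RHS]reprK; apply/eqmodP; exact: geodesic0.
  + by rewrite -[RHS]reprK; apply/eqmodP; exact: geodesic1.
Qed.
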